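(* Let $D$ be a digraph on at least $2$ vertices whose skew adjacency matrix satisfies $\ker(A_D)=\operatorname{span}(\mathbf{1})$. Then there is a constant $c>0$ (depending on $D$) such that $S_D(n\cdot\mathbf{1})\ge c\sqrt{n}$ for all $n\ge1$.
   Context: A digraph $D$ has a finite vertex set $V(D)$ and a set $E(D)$ of ordered pairs of distinct vertices (arcs), with at most one arc between any pair. $N^+(v)=\{u:vu\in E(D)\}$, $N^-(v)=\{u:uv\in E(D)\}$. The skew adjacency matrix $A_D$ is indexed by $V(D)$ with $(A_D)_{ij}=1$ if $ij\in E(D)$, $-1$ if $ji\in E(D)$, $0$ otherwise; $\mathbf{1}$ is the all-ones vector. A restriction vector is a vector $\mathbf{r}$ of nonnegative integers indexed by $V(D)$; $\operatorname{supp}(\mathbf{r})=\{v:\mathbf{r}_v>0\}$; $\delta_v$ is the indicator vector of $v$. Semi-restricted $D$-game with parameter $\mathbf{r}$: Rei and Norman play $\sum_u\mathbf{r}_u$ rounds; in each round both simultaneously choose a vertex, Rei being required to choose each $u$ exactly $\mathbf{r}_u$ times overall, Norman unrestricted. A strategy for Norman is a function $\mathcal{N}$ assigning to each restriction vector a random variable with values in $V(D)$; a strategy for Rei is a function $\mathcal{R}$ assigning to each $\mathbf{r}$ a random variable with values in $\operatorname{supp}(\mathbf{r})$ (choices independent across players and rounds). Norman's score is defined recursively: $0$ if $\mathbf{r}=0$; otherwise with $x=\mathcal{N}(\mathbf{r})$, $y=\mathcal{R}(\mathbf{r})$, Norman gains $+1$ if $y\in N^+(x)$, $-1$ if $y\in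 N^-(x)$, $0$ otherwise, and play continues from $\mathbf{r}-\delta_y$. $S_D(\mathbf{r};\mathcal{N},\mathcal{R})$ is the expected score, $S_D(\mathbf{r};\mathcal{R})=\max_{\mathcal{N}}S_D(\mathbf{r};\mathcal{N},\mathcal{R})$, $S_D(\mathbf{r})=\min_{\mathcal{R}}S_D(\mathbf{r};\mathcal{R})$. *)

(* Defs.v *)
From HB Require Import structures.
From mathcomp Require Import all_boot all_order all_algebra.
From mathcomp Require Import boolp classical_sets reals.

Set Implicit Arguments.
Unset Strict Implicit.
Unset Printing Implicit Defensive.

Import Order.TTheory GRing.Theory Num.Theory.
Local Open Scope classical_set_scope.
Local Open Scope ring_scope.

Record digraph (V : finType) := Digraph {
  arc : rel V;
  arc_irr : forall u, ~~ arc u u;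
  arc_asym : forall u v, arc u v -> ~~ arc v u
}.

Definition out_nbr (V : finType) (D : digraph V) (v : V) : {set V} :=
  [set u | arc D v u]%SET.

Definition in_nbr (V : finType) (D : digraph V) (v : V) : {set V} :=
  [set u | arc D u v]%SET.

(* Vertices are numbered by enum_val; the kernel condition used below does not
   depend on this numbering. *)
Definition skew_adj (R : realType) (V : finType) (D : digraph V)
    : 'M[R]_#|V| :=
  \matrix_(i, j)
    (if arc D (enum_val i) (enum_val j) then 1
     else if arc D (enum_val j) (enum_val i) then -1 else 0).

Section Game.
Variables (R : realType) (V : finType) (D : digraph V).

Definition restriction := {ffun V -> nat}.

Definition restriction_supp (r : restriction) : {set V} :=
  [set v | (0 < r v)%N]%SET.

Definition rounds (r : restriction) : nat := (\sum_v r v)%N.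

(* r - delta_y; the truncation of subtraction matters only off the support. *)
Definition play_off (r : restriction) (y : V) : restriction :=
  [ffun v => (r v - (v == y))%N].

(* A V-valued random variable is represented by its law. *)
Definition is_law (p : V -> R) : Prop :=
  (forall v, 0 <= p v) /\ \sum_v p v = 1.

Definition strategy := restriction -> V -> R.

Definition norman_strategy (N : strategy) : Prop := forall r, is_law (N r).

(* When r = 0 the game is over, and no law is supported on the empty set. *)
Definition rei_strategy (Q : strategy) : Prop :=
  forall r, restriction_supp r != finset.set0 ->
    is_law (Q r) /\ (forall v, v \notin restriction_supp r -> Q r v = 0).

(* Norman's gain when Norman plays x and Rei plays y. *)
Definition gain (x y : V) : R :=
  if y \in out_nbr D x then 1 else if y \in in_nbr D x then -1 else 0.

(* A play lists the pairs (Norman's choice, Rei's choice) round by round. *)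
Fixpoint play_score (h : seq (V * V)) : R :=
  if h is (x, y) :: h' then gain x y + play_score h' else 0.

Fixpoint play_prob (N Q : strategy) (r : restriction) (h : seq (V * V)) : R :=
  if h is (x, y) :: h' then
    N r x * Q r y * play_prob N Q (play_off r y) h'
  else 1.

(* S_D(r; N, Q) *)
Definition expected_score (r : restriction) (N Q : strategy) : R :=
  \sum_(h : (rounds r).-tuple (V * V)) play_prob N Q r h * play_score h.

(* S_D(r; Q) *)
Definition score_against (r : restriction) (Q : strategy) : R :=
  sup [set s | exists2 N, norman_strategy N & s = expected_score r N Q].

(* S_D(r) *)
Definition game_value (r : restriction) : R :=
  inf [set s | exists2 Q, rei_strategy Q & s = score_against r Q].

(* The next lemmas show that sup and inf above are never taken of an empty or
   unbounded set, as soon as V is nonempty. *)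

Lemma big_tuple_cons n (F : seq (V * V) -> R) :
  \sum_(h : n.+1.-tuple (V * V)) F h =
  \sum_x \sum_y \sum_(h : n.-tuple (V * V)) F ((x, y) :: h).
Proof.
rewrite pair_big pair_big /=.
rewrite (reindex (fun p : (V * V) * n.-tuple (V * V) => cons_tuple p.1 p.2)) /=.
  by apply: eq_bigr => -[[x y] h] _.
exists (fun h : n.+1.-tuple (V * V) => (thead h, [tuple of behead h])).
  by move=> [z h] _; congr pair; apply: val_inj.
by move=> h _; rewrite [RHS]tuple_eta; apply: val_inj.
Qed.

Lemma rounds_gt0 r : (0 < rounds r)%N = (restriction_supp r != finset.set0).
Proof.
apply/idP/set0Pn => [|[v]].
  rewrite lt0n sum_nat_eq0 negb_forall => /existsP[v]; rewrite -lt0n => rv.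
  by exists v; rewrite inE.
by rewrite inE => rv; rewrite /rounds (bigD1 v) //= addn_gt0 rv.
Qed.

Lemma rounds_play_off r y : y \in restriction_supp r ->
  rounds r = (rounds (play_off r y)).+1.
Proof.
rewrite inE => ry; rewrite /rounds (bigD1 y) //= [in RHS](bigD1 y) //=.
rewrite ffunE eqxx -addSn subn1 prednK //; congr addn.
by apply: eq_bigr => v /negbTE vy; rewrite ffunE vy subn0.
Qed.

Lemma sum_play_prob N Q n r : norman_strategy N -> rei_strategy Q ->
  rounds r = n -> \sum_(h : n.-tuple (V * V)) play_prob N Q r h = 1.
Proof.
move=> HN HQ; elim: n r => [|n IH] r rn.
  by rewrite (big_pred1 [tuple]) //= => h; apply/esym/eqP; exact: tuple0.
have [[Q0 Q1] Qs] : is_law (Q r) /\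
    (forall v, v \notin restriction_supp r -> Q r v = 0).
  by apply: HQ; rewrite -rounds_gt0 rn.
have [N0 N1] := HN r.
rewrite (big_tuple_cons _ (play_prob N Q r)) -[RHS]N1; apply: eq_bigr => x _.
rewrite -[RHS]mulr1 -Q1 mulr_sumr; apply: eq_bigr => y _ /=.
rewrite -mulr_sumr; have [ys|ys] := boolP (y \in restriction_supp r).
  by rewrite IH ?mulr1 //; move: (rounds_play_off ys); rewrite rn => -[].
by rewrite Qs // !(mulr0, mul0r).
Qed.

Lemma expected_score0 r N Q : rounds r = 0%N -> expected_score r N Q = 0.
Proof.
rewrite /expected_score => ->; apply: big1 => h _.
by rewrite (tuple0 h) /= mulr0.
Qed.

Lemma expected_score_rec r N Q : norman_strategy N -> rei_strategy Q ->
  (0 < rounds r)%N ->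
  expected_score r N Q = \sum_x \sum_y
    N r x * Q r y * (gain x y + expected_score (play_off r y) N Q).
Proof.
move=> HN HQ r0.
have [_ Qs] : is_law (Q r) /\
    (forall v, v \notin restriction_supp r -> Q r v = 0).
  by apply: HQ; rewrite -rounds_gt0.
rewrite /expected_score; case E: (rounds r) r0 => [//|n] _.
rewrite (big_tuple_cons _ (fun h => play_prob N Q r h * play_score h)).
apply: eq_bigr => x _; apply: eq_bigr => y _ /=.
have [ys|ys] := boolP (y \in restriction_supp r); last first.
  by rewrite Qs // !(mulr0, mul0r) big1 // => h _; rewrite !mul0r.
have := rounds_play_off ys; rewrite E => -[En]; rewrite -En.
rewrite -[gain x y in RHS]mul1r -(sum_play_prob HN HQ (esym En)).
rewrite mulr_suml -big_split mulr_sumr /=; apply: eq_bigr => h _.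
by rewrite -mulrA; congr (_ * _); rewrite mulrDr.
Qed.

Lemma expected_score_bound r N Q : norman_strategy N -> rei_strategy Q ->
  `|expected_score r N Q| <= (rounds r)%:R.
Proof.
move=> HN HQ; move E: (rounds r) => n; elim: n r E => [|n IH] r E.
  by rewrite expected_score0 // normr0.
have [[Q0 Q1] Qs] : is_law (Q r) /\
    (forall v, v \notin restriction_supp r -> Q r v = 0).
  by apply: HQ; rewrite -rounds_gt0 E.
have [N0 N1] := HN r.
rewrite expected_score_rec ?E //.
apply: le_trans (ler_norm_sum _ _ _) _.
have -> : n.+1%:R = \sum_x N r x * n.+1%:R :> R by rewrite -mulr_suml N1 mul1r.
apply: ler_sum => x _.
apply: le_trans (ler_norm_sum _ _ _) _.
have -> : n.+1%:R = \sum_y Q r y * n.+1%:R :> R by rewrite -mulr_suml Q1 mul1r.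
rewrite mulr_sumr; apply: ler_sum => y _.
have [ys|ys] := boolP (y \in restriction_supp r); last first.
  by rewrite Qs // !(mulr0, mul0r) normr0.
rewrite !normrM (ger0_norm (N0 x)) (ger0_norm (Q0 y)) -mulrA.
do 2![apply: ler_wpM2l => //].
apply: le_trans (ler_normD _ _) _; rewrite -natr1 addrC lerD //.
  by apply: IH; move: (rounds_play_off ys); rewrite E => -[].
by rewrite /gain; case: ifP => _; [|case: ifP => _];
  rewrite ?normrN ?normr1 ?normr0.
Qed.

Lemma exists_norman_strategy : (0 < #|V|)%N -> exists N, norman_strategy N.
Proof.
case/card_gt0P=> v0 _; exists (fun _ v => (v == v0)%:R) => r; split=> [v|].
  exact: ler0n.
rewrite (bigD1 v0) //= eqxx big1 ?addr0 // => v /negbTE ->.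
by [].
Qed.

Lemma exists_rei_strategy : exists Q, rei_strategy Q.
Proof.
exists (fun r v => ([pick u in restriction_supp r] == Some v)%:R).
move=> r /set0Pn[u0 u0r]; case: pickP => [u ur|/(_ u0)]; last by rewrite u0r.
split=> [|v vr]; last by case: eqP vr => // -[<-]; rewrite ur.
split=> [v|]; first exact: ler0n.
rewrite (bigD1 u) //= eqxx big1 ?addr0 // => v vu.
by rewrite (inj_eq Some_inj) eq_sym (negbTE vu).
Qed.

Lemma has_sup_score_against r Q : (0 < #|V|)%N -> rei_strategy Q ->
  has_sup [set s | exists2 N, norman_strategy N & s = expected_score r N Q].
Proof.
move=> V0 HQ; split.
  by have [N HN] := exists_norman_strategy V0; exists (expected_score r N Q), N.
exists (rounds r)%:R => _ [N HN ->].
exact: le_trans (ler_norm _) (expected_score_bound r HN HQ).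
Qed.

Lemma has_inf_game_value r : (0 < #|V|)%N ->
  has_inf [set s | exists2 Q, rei_strategy Q & s = score_against r Q].
Proof.
move=> V0; split.
  by have [Q HQ] := exists_rei_strategy; exists (score_against r Q), Q.
exists (- (rounds r)%:R) => _ [Q HQ ->].
have [N HN] := exists_norman_strategy V0.
apply: (@le_trans _ _ (expected_score r N Q)).
  by have := expected_score_bound r HN HQ; rewrite ler_norml => /andP[].
by apply: sup_upper_bound; [exact: has_sup_score_against | exists N].
Qed.

End Game.

(* Main.v *)
(* Norman answers each round with a best reply to Rei's current law q. Since
   ker A is spanned by 1, the best gain max (A q) is at least
   k * (|q v - 1/|V|| + |q w - 1/|V||) for two fixed vertices v <> w and some k > 0.
   The difference r v - r w performs, when q is uniform, a lazy symmetric walk,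
   so k * E|r v - r w + S_m|, where S_m is the walk after the m remaining
   rounds, is a martingale; as it is 1-Lipschitz (up to k), any deviation of q
   from uniform is paid for by Norman's gain. Hence this potential bounds his
   score from below, and it is of order sqrt n at n * 1 by comparison of the
   second and fourth moments. *)
Require Import Defs.
From mathcomp Require Import all_boot all_order all_algebra.
From mathcomp Require Import reals boolp.
From mathcomp Require Import ring lra.

Import Order.TTheory GRing.Theory Num.Theory.
Local Open Scope ring_scope.

(** * The lazy symmetric walk *)

(* E|z + S_m| for the walk S with steps 1, -1, 0 of probabilities p, p, 1 - 2p. *)
Fixpoint walk_abs (R : realType) (p : R) (m : nat) (z : R) : R :=
  if m is m'.+1 then
    let W := walk_abs R p m' in W z + p * (W (z + 1) + W (z - 1) - 2 * W z)
  else `|z|.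

(** For [p <= 1/2] a step of the recursion is a convex combination of translates, with weights [p],
    [p], [1 - 2p], so it keeps the Lipschitz constant of the absolute value. *)
Lemma walk_abs_lipschitz (R : realType) (p : R) (m : nat) (x y : R) :
  0 <= p -> p <= 2^-1 -> `|walk_abs R p m x - walk_abs R p m y| <= `|x - y|.
Proof.
move=> p0 p1; elim: m x y => [|m IH] x y /=; first exact: ler_dist_dist.
have := IH x y; have := IH (x + 1) (y + 1); have := IH (x - 1) (y - 1).
rewrite (_ : x - 1 - (y - 1) = x - y); last by ring.
rewrite (_ : x + 1 - (y + 1) = x - y); last by ring.
rewrite !ler_norml => /andP[a1 a2] /andP[b1 b2] /andP[c1 c2].
have q0 : 0 <= 1 - 2 * p by lra.
set d := `|x - y| in a1 a2 b1 b2 c1 c2 *.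
by apply/andP; split; nra.
Qed.

(* The bound is E(Z^2)/t - E(Z^4)/t^3 for Z = z + S_m, from u^2 - u^4 <= |u|. *)
Lemma walk_abs_moments (R : realType) (p t : R) (m : nat) (z : R) :
  0 <= p -> p <= 2^-1 -> 0 < t ->
  (z ^+ 2 + 2 * p * m%:R) / t
  - (z ^+ 4 + 12 * p * z ^+ 2 * m%:R + 12 * p ^+ 2 * m%:R * (m%:R - 1)
     + 2 * p * m%:R) / t ^+ 3 <= walk_abs R p m z.
Proof.
move=> p0 p1 t0; elim: m z => [|m IH] z /=.
  rewrite !(mulr0, mul0r, addr0).
  have z2 : z ^+ 2 = `|z| ^+ 2 by rewrite real_normK ?num_real.
  rewrite -[4%N]/(2 * 2)%N exprM z2 -exprM.
  have w0 : 0 <= `|z| / t by rewrite divr_ge0 // ltW.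
  have -> : `|z| ^+ 2 / t - `|z| ^+ 4 / t ^+ 3
    = t * ((`|z| / t) ^+ 2 - (`|z| / t) ^+ 4) by field; rewrite gt_eqF.
  have zE : `|z| = t * (`|z| / t) by field; rewrite gt_eqF.
  rewrite [leRHS]zE ler_pM2l //.
  set w := _ / t in w0 *.
  have [w1|w1] := lerP w 1; nra.
have q0 : 0 <= 1 - 2 * p by lra.
have := ler_wpM2l q0 (IH z).
have := ler_wpM2l p0 (IH (z + 1)).
have := ler_wpM2l p0 (IH (z - 1)).
move=> a b c; have := lerD (lerD a b) c.
rewrite -natr1.
set W := walk_abs R p m.
rewrite (_ : p * W (z - 1) + p * W (z + 1) + (1 - 2 * p) * W z
  = W z + p * (W (z + 1) + W (z - 1) - 2 * W z)); last by ring.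
(* The second and fourth moments satisfy the recursion of the walk exactly, so nothing is lost after
   the base case. *)
apply: le_trans; rewrite le_eqVlt; apply/orP; left; apply/eqP.
by field; rewrite gt_eqF.
Qed.

(** * Gains and the kernel of the skew adjacency matrix *)

Lemma gainN (R : realType) (V : finType) (D : digraph V) (x y : V) :
  gain R D x y = - gain R D y x.
Proof.
rewrite /gain !inE; have := @arc_asym V D x y; have := @arc_asym V D y x.
by case: (Defs.arc D x y); case: (Defs.arc D y x) => //= a b;
  rewrite ?opprK ?oppr0 //; move: (a isT).
Qed.

Lemma skew_adjE (R : realType) (V : finType) (D : digraph V) i j :
  skew_adj R D i j = gain R D (enum_val i) (enum_val j).
Proof. by rewrite mxE /gain !inE. Qed.

Lemma sum_enum_val (R : realType) (V : finType) (F : V -> R) :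
  \sum_(i < #|V|) F (enum_val i) = \sum_v F v.
Proof.
by rewrite (reindex (@enum_val V V)) //; exact/onW_bij/enum_val_bij.
Qed.

Section KernelOnes.
Variables (R : realType) (V : finType) (D : digraph V).
Hypothesis ker_A : forall x : 'cV[R]_#|V|,
  skew_adj R D *m x = 0 <-> exists a : R, x = a *: const_mx 1.

Lemma sum_gain (x : V) : \sum_y gain R D x y = 0.
Proof.
have /ker_A/matrixP/(_ (enum_rank x) ord0) :
    exists a : R, const_mx 1 = a *: const_mx 1 :> 'cV[R]_#|V|.
  by exists 1; rewrite scale1r.
rewrite !mxE -sum_enum_val => e; rewrite -[RHS]e; apply: eq_bigr => i _.
by rewrite skew_adjE enum_rankK mxE mulr1.
Qed.

(* The functional [q |-> q v - 1/|V|] on laws is linear and vanishes on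
   [ker A], so it lies in the row space of [A]. *)
Lemma dev_row_space (v : V) : exists c : V -> R, forall q : V -> R,
  \sum_y q y = 1 ->
  q v - #|V|%:R^-1 = \sum_x c x * \sum_y q y * gain R D x y.
Proof.
have k0 : #|V|%:R != 0 :> R by rewrite pnatr_eq0 -lt0n; apply/card_gt0P; exists v.
pose d : 'rV[R]_#|V| := \row_j ((enum_val j == v)%:R - #|V|%:R^-1).
(* Each column of the cokernel lies in [ker A], hence is constant, and [d] annihilates it because
   the entries of [d] sum to 0. *)
have /submxP[c dE] : (d <= skew_adj R D)%MS.
  rewrite submxE; apply/eqP/matrixP => i j.
  have : skew_adj R D *m col j (cokermx (skew_adj R D)) = 0.
    by rewrite colE mulmxA mulmx_coker mul0mx.
  case/ker_A => a aE.
  have aE' l : cokermx (skew_adj R D) l j = a.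
    by move/matrixP/(_ l ord0): aE; rewrite !mxE mulr1.
  rewrite !mxE; under eq_bigr do rewrite aE' mxE.
  rewrite -mulr_suml (sum_enum_val _ _ (fun u => (u == v)%:R - #|V|%:R^-1)).
  rewrite sumrB sumr_const -(mulr_natl #|V|%:R^-1) mulfV //.
  rewrite (bigD1 v) //= eqxx big1 ?addr0 ?subrr ?mul0r //.
  by move=> u /negbTE ->.
exists (fun x => c ord0 (enum_rank x)) => q q1.
have -> : q v - #|V|%:R^-1 = \sum_y ((y == v)%:R - #|V|%:R^-1) * q y.
  under eq_bigr do rewrite mulrBl.
  rewrite sumrB -mulr_sumr q1 mulr1 (bigD1 v) //= eqxx mul1r big1 ?addr0 //.
  by move=> u /negbTE ->; rewrite mul0r.
rewrite -(sum_enum_val _ _ (fun y => _ * q y)) -(sum_enum_val R V).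
under [RHS]eq_bigr do rewrite mulr_sumr enum_valK -(sum_enum_val R V).
rewrite exchange_big /=; apply: eq_bigr => j _.
move/matrixP/(_ ord0 j): dE; rewrite !mxE => ->.
by rewrite mulr_suml; apply: eq_bigr => i _; rewrite skew_adjE; ring.
Qed.

(** The deviation is a fixed combination of the gains [G x]. By skew symmetry and zero row sums the
    gains add up to 0, so an upper bound [M] on all of them also gives [|G x| <= M * |V|]. *)
Lemma dev_le_max_gain (v : V) : exists2 C : R, 0 < C &
  forall (q : V -> R) (M : R), \sum_y q y = 1 ->
    (forall x, \sum_y q y * gain R D x y <= M) -> `|q v - #|V|%:R^-1| <= C * M.
Proof.
have [c cE] := dev_row_space v.
have k1 : 1 <= #|V|%:R :> R by rewrite ler1n; apply/card_gt0P; exists v.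
(* Adding 1 ensures that the constant is positive. *)
exists (1 + (\sum_x `|c x|) * #|V|%:R).
  by rewrite ltr_wpDr // mulr_ge0 // sumr_ge0.
move=> q M q1 leM; pose G x := \sum_y q y * gain R D x y.
have leG x : G x <= M := leM x.
have G0 : \sum_x G x = 0.
  rewrite /G exchange_big big1 //= => y _.
  rewrite -mulr_sumr; under eq_bigr do rewrite gainN.
  by rewrite sumrN sum_gain oppr0 mulr0.
have rest x : \sum_(u | u != x) G u <= M * #|V|%:R - M.
  apply: (@le_trans _ _ (\sum_(u | u != x) M)).
    by apply: ler_sum => u _; exact: leG.
  have : \sum_(u : V) M = M * #|V|%:R by rewrite sumr_const mulr_natr.
  by rewrite (bigD1 x) //=; lra.
have M0 : 0 <= M.
  have : \sum_x G x <= \sum_(x : V) M by apply: ler_sum => x _; exact: leG.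
  by rewrite G0 sumr_const -[M *+ _]mulr_natr pmulr_lge0 // (lt_le_trans ltr01 k1).
have absG x : `|G x| <= M * #|V|%:R.
  have := rest x; have := leG x; move: G0; rewrite (bigD1 x) //= => e a b.
  have := ler_peMr M0 k1; rewrite ler_norml => d; apply/andP; split; lra.
rewrite cE //; apply: le_trans (ler_norm_sum _ _ _) _.
apply: (@le_trans _ _ (\sum_x `|c x| * (M * #|V|%:R))).
  by apply: ler_sum => x _; rewrite normrM; apply: ler_wpM2l (absG x).
rewrite -mulr_suml mulrDl mul1r.
by rewrite [M * _]mulrC mulrA lerDr.
Qed.

(** Take [x] of maximal gain: this one gain bounds both deviations, and the two bounds add up. *)
Lemma gain_ge_dev (v w : V) : exists2 k : R, 0 < k &
  forall q : V -> R, \sum_y q y = 1 ->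
    exists x, k * (`|q v - #|V|%:R^-1| + `|q w - #|V|%:R^-1|)
              <= \sum_y q y * gain R D x y.
Proof.
have [C C0 Cv] := dev_le_max_gain v; have [C' C'0 Cw] := dev_le_max_gain w.
exists (C + C')^-1; first by rewrite invr_gt0 addr_gt0.
move=> q q1; pose G x := \sum_y q y * gain R D x y.
case: (@Order.TotalTheory.arg_maxP _ _ V v xpredT G isT) => x _ xmax.
exists x; rewrite ler_pdivrMl ?addr_gt0 // mulrDl.
by apply: lerD; [apply: Cv | apply: Cw] => // u; exact: xmax.
Qed.

End KernelOnes.

(** * The potential bounds Norman's score *)

Lemma expected_score_ge_walk (R : realType) (V : finType) (D : digraph V)
    (v w : V) (k : R) (N Q : strategy R V) :
  v != w -> 0 <= k -> norman_strategy N -> rei_strategy Q ->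
  (forall r, restriction_supp r != finset.set0 ->
     k * (`|Q r v - #|V|%:R^-1| + `|Q r w - #|V|%:R^-1|)
     <= \sum_x \sum_y N r x * Q r y * gain R D x y) ->
  forall r, k * walk_abs R #|V|%:R^-1 (rounds r) ((r v)%:R - (r w)%:R)
            <= expected_score D r N Q.
Proof.
move=> vw k0 HN HQ hN r; move E: (rounds r) => n; elim: n r E => [|n IH] r E.
  rewrite expected_score0 //=.
  move/eqP: E; rewrite sum_nat_eq0 => /forallP r0.
  by rewrite (eqP (r0 v)) (eqP (r0 w)) subrr normr0 mulr0.
have rs : restriction_supp r != finset.set0 by rewrite -rounds_gt0 E.
have [[Q0 Q1] Qs] := HQ r rs; have [N0 N1] := HN r.
set z := _ - _; set p := #|V|%:R^-1; set W := walk_abs R p n.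
have card2 : 2 <= #|V|%:R :> R.
  by rewrite ler_nat; apply/card_gt1P; exists v, w.
have p0 : 0 <= p by rewrite invr_ge0 ler0n.
have p1 : p <= 2^-1 by rewrite lef_pV2 ?posrE //; lra.
rewrite expected_score_rec ?E //.
have -> : \sum_x \sum_y N r x * Q r y *
      (gain R D x y + expected_score D (play_off r y) N Q)
  = \sum_x \sum_y N r x * Q r y * gain R D x y
    + \sum_y Q r y * expected_score D (play_off r y) N Q.
  rewrite -[X in _ + X]mul1r -N1 mulr_suml -big_split /=; apply: eq_bigr => x _.
  rewrite mulr_sumr -big_split /=; apply: eq_bigr => y _; ring.
apply: le_trans (lerD (hN r rs) _); last first.
  apply: (@ler_sum _ _ _ _
    (fun y => Q r y * (k * W (z - (y == v)%:R + (y == w)%:R)))) => y _.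
  have [ys|ys] := boolP (y \in restriction_supp r); last by rewrite Qs // !mul0r.
  apply: ler_wpM2l => //.
  have := IH (play_off r y); rewrite -/W.
  (* As [y] is in the support, the subtraction in [play_off] is not truncated. *)
  have -> : (play_off r y v)%:R - (play_off r y w)%:R
      = z - (y == v)%:R + (y == w)%:R :> R.
    move: ys; rewrite inE => ry; rewrite !ffunE !natrB.
    - by rewrite /z ![_ == y]eq_sym; ring.
    - by case: eqP => // ->.
    - by case: eqP => // ->.
  by apply; move: (rounds_play_off ys); rewrite E => -[].
have -> : \sum_y Q r y * (k * W (z - (y == v)%:R + (y == w)%:R))
    = k * (W z + Q r v * (W (z - 1) - W z) + Q r w * (W (z + 1) - W z)).
  have Wy y : W (z - (y == v)%:R + (y == w)%:R)
      = W z + (y == v)%:R * (W (z - 1) - W z) + (y == w)%:R * (W (z + 1) - W z).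
    have [->|_] := eqVneq y v.
      by rewrite (negbTE vw) /= mulr1n mulr0n addr0; ring.
    by have [_|_] := eqVneq y w; rewrite /= ?mulr1n mulr0n subr0 ?addr0; ring.
  have pick u (c : R) : \sum_y Q r y * ((y == u)%:R * c) = Q r u * c.
    rewrite (bigD1 u) //= eqxx mul1r big1 ?addr0 // => y /negbTE ->.
    by rewrite mul0r mulr0.
  have Wz : \sum_y Q r y * W z = W z by rewrite -mulr_suml Q1 mul1r.
  rewrite -!pick -[X in k * (X + _ + _)]Wz -!big_split mulr_sumr /=.
  by apply: eq_bigr => y _; rewrite Wy; ring.
rewrite -mulrDr ler_wpM2l //=.
rewrite -/W.
have := walk_abs_lipschitz R p n (z + 1) z p0 p1.
have := walk_abs_lipschitz R p n (z - 1) z p0 p1.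
rewrite -/W (_ : z - 1 - z = - 1); last by ring.
rewrite (_ : z + 1 - z = 1); last by ring.
rewrite normrN normr1 => a b.
(* Replacing [Q r v] by [p] changes the mean potential by the deviation times an increment of [W] of
   size at most 1; likewise for [w]. The gain in [hN] covers both losses. *)
have cost (d e : R) : `|e| <= 1 -> - `|d| <= d * e.
  by move=> e1; rewrite lerNl (le_trans (ler_norm _)) // normrN normrM ler_piMr.
have := cost (Q r v - p) _ a; have := cost (Q r w - p) _ b.
nra.
Qed.

Lemma walk_abs_ge_sqrt (R : realType) (p : R) (m n : nat) :
  0 <= p -> p <= 2^-1 -> (1 <= n)%N -> p * m%:R = n%:R ->
  4 / 27 * Num.sqrt n%:R <= walk_abs R p m 0.
Proof.
move=> p0 p1 n1 pm; set s := Num.sqrt n%:R.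
have n1R : 1 <= n%:R :> R by rewrite ler1n.
have s0 : 0 < s by rewrite sqrtr_gt0; lra.
have s2 : s ^+ 2 = n%:R by rewrite sqr_sqrtr //; lra.
(* For [t = a * s] the leading coefficient is [2/a - 12/a^3], positive once [a^2 > 6]; [a = 3] gives
   [2/9]. *)
have t0 : 0 < 3 * s by lra.
apply: le_trans (walk_abs_moments R p (3 * s) m 0 p0 p1 t0).
have -> : (0 ^+ 2 + 2 * p * m%:R) / (3 * s)
  - (0 ^+ 4 + 12 * p * 0 ^+ 2 * m%:R + 12 * p ^+ 2 * m%:R * (m%:R - 1)
     + 2 * p * m%:R) / (3 * s) ^+ 3
  = (2 * (p * m%:R)) / (3 * s)
    - (12 * (p * m%:R) ^+ 2 - 12 * p * (p * m%:R) + 2 * (p * m%:R)) / (3 * s) ^+ 3.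
  by field; rewrite gt_eqF.
rewrite pm -s2.
(* Of [2/9 = 6/27], the part [2/27] absorbs the lower-order loss [2 / (27 * s)], as
   [s ^+ 2 = n >= 1]. *)
have -> : 2 * s ^+ 2 / (3 * s)
    - (12 * (s ^+ 2) ^+ 2 - 12 * p * s ^+ 2 + 2 * s ^+ 2) / (3 * s) ^+ 3
  = 4 / 27 * s + (2 * (s ^+ 2 - 1) + 12 * p) / (27 * s).
  by field; rewrite gt_eqF.
by rewrite lerDl divr_ge0 //; lra.
Qed.

Theorem theorem3p3 (R : realType) (V : finType) (D : digraph V)
    (card_V : (2 <= #|V|)%N)
    (ker_A : forall x : 'cV[R]_#|V|,
       skew_adj R D *m x = 0 <-> exists a : R, x = a *: const_mx 1) :
  exists2 c : R, 0 < c &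
    forall n : nat, (1 <= n)%N ->
      c * Num.sqrt n%:R <= game_value R D [ffun _ => n].
Proof.
have V0 : (0 < #|V|)%N by apply: leq_trans card_V.
have /card_gt1P[v [w [_ _ vw]]] : (1 < #|V|)%N by [].
have [k k0 kP] := gain_ge_dev R V D ker_A v w.
exists (k * (4 / 27)); first by rewrite mulr_gt0 // divr_gt0.
move=> n n1; set r0 : restriction V := [ffun _ => n].
have [inf0 _] := has_inf_game_value R D r0 V0.
apply: lb_le_inf => // _ [Q HQ ->].
have /choice[best bestP] : forall r, exists x,
    restriction_supp r != finset.set0 ->
    k * (`|Q r v - #|V|%:R^-1| + `|Q r w - #|V|%:R^-1|)
    <= \sum_y Q r y * gain R D x y.
  move=> r; have [rs|/negP rs] := boolP (restriction_supp r != finset.set0).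
    by have [x xP] := kP (Q r) (HQ r rs).1.2; exists x.
  (* The game is over here, so any vertex serves as a default. *)
  by exists v.
pose N : strategy R V := fun r x => (x == best r)%:R.
have pickN r (F : V -> R) : \sum_x N r x * F x = F (best r).
  rewrite /N (bigD1 (best r)) //= eqxx mul1r big1 ?addr0 // => x /negbTE ->.
  by rewrite mul0r.
have HN : norman_strategy N.
  move=> r; split=> [x|]; first exact: ler0n.
  by rewrite -[RHS](pickN r (fun _ => 1)); apply: eq_bigr => x _; rewrite mulr1.
apply: (@le_trans _ _ (expected_score D r0 N Q)); last first.
  by apply: sup_upper_bound; [exact: has_sup_score_against | exists N].
apply: le_trans
  (expected_score_ge_walk R V D v w k N Q vw (ltW k0) HN HQ _ r0); last first.
  move=> r /bestP; rewrite -(pickN r (fun x => \sum_y Q r y * gain R D x y)).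
  congr (_ <= _); apply: eq_bigr => x _.
  by rewrite mulr_sumr; apply: eq_bigr => y _; rewrite mulrA.
have card2 : 2 <= #|V|%:R :> R by rewrite ler_nat.
rewrite -mulrA ler_wpM2l ?(ltW k0) // !ffunE subrr walk_abs_ge_sqrt //.
- by rewrite invr_ge0 ler0n.
- by rewrite lef_pV2 ?posrE //; lra.
(* There are [|V| * n] rounds, so [p * m = n] for [p = 1/|V|]. *)
- rewrite /rounds; under eq_bigr do rewrite ffunE.
  by rewrite sum_nat_const natrM mulKf // pnatr_eq0 -lt0n.
Qed.
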